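(* A connected graph $G$ is $(\iota,1)$-critical if and only if, for every minimum isolating set $D$ of $G$, the triple $(D,\,N(D),\,V(G)\setminus N[D])$ is a critical tripartition of $G$.
   Context: For $D\subseteq V(G)$, $N[D]$ is the set of vertices of $D$ and all their neighbours, and $N(D)=N[D]\setminus D$. $D$ is an isolating set of $G$ if $G-N[D]$ has no edges; $\iota(G)$ is the minimum size of an isolating set, and a minimum isolating set is one of size $\iota(G)$. For $e\in E(G)$, $G_e$ is obtained by subdividing $e$ once. $G$ is $(\iota,1)$-critical if $\iota(G_e)>\iota(G)$ for every edge $e\in E(G)$ (and $E(G)\neq\emptyset$). A set $S$ is a $3$-packing if any two distinct vertices of $S$ are at distance greater than $3$. A triple $(A,B,C)$ of non-empty sets partitioning $V(G)$ is a critical tripartition of $G$ if: (i) $A\cup C$ and $B$ are independent sets of $G$; (ii) $N(A)=B=N(C)$; (iii) $A$ is a $3$-packing of $G$; (iv) no vertex of $A$ is a leaf (degree-one vertex) of $G$. *)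

(* Defs.v *)
From mathcomp Require Import all_boot.
Set Implicit Arguments.
Unset Strict Implicit.
Unset Printing Implicit Defensive.

Record sgraph := SGraph {
  vertex :> finType;
  adj : rel vertex;
  adj_sym : symmetric adj;
  adj_irrefl : irreflexive adj }.

Definition connected (G : sgraph) : Prop :=
  forall x y : G, connect (@adj G) x y.

Section Graph.
Variable G : sgraph.
Implicit Types (x y u v : G) (A B C D S : {set G}).

Definition clneigh D : {set G} := D :|: [set v | [exists u in D, adj u v]].

Definition opneigh D : {set G} := clneigh D :\: D.

Definition independent S : bool :=
  [forall u in S, forall v in S, ~~ adj u v].

Definition isolating D : bool := independent (~: clneigh D).

(* [setT] is isolating, so the minimum ranges over a nonempty family. *)
Definition isolation_number : nat :=
  #|[arg min_(D < [set: G] | isolating D) #|D|]|.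

Definition min_isolating D : Prop :=
  isolating D /\ #|D| = isolation_number.

Definition degree v : nat := #|[set w | adj v w]|.

Definition leaf v : bool := degree v == 1.

(* The relation holds for no [k] when [x] and [y] lie in different components,
   i.e. when their distance is infinite. *)
Definition is_dist x y (k : nat) : Prop :=
  (exists p : seq G, [/\ path (@adj G) x p, last x p = y & size p = k]) /\
  (forall p : seq G, path (@adj G) x p -> last x p = y -> k <= size p).

Definition packing (r : nat) S : Prop :=
  forall x y, x \in S -> y \in S -> x != y ->
  forall k, is_dist x y k -> r < k.

Record critical_tripartition A B C : Prop := CriticalTripartition {
  ct_nonempty : [/\ A != set0, B != set0 & C != set0];
  ct_disjoint : [/\ [disjoint A & B], [disjoint A & C] & [disjoint B & C]];
  ct_cover : A :|: B :|: C = [set: G];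
  ct_indep : independent (A :|: C) /\ independent B;
  ct_neigh : opneigh A = B /\ opneigh C = B;
  ct_packing : packing 3 A;
  ct_noleaf : forall v, v \in A -> ~~ leaf v }.

Variables x y : G.

(* Vertices are [Some v] for the old vertices and [None] for the new one. *)
Definition subdiv_adj (a b : option G) : bool :=
  match a, b with
  | Some u, Some v => adj u v && ([set u; v] != [set x; y])
  | Some u, None => u \in [set x; y]
  | None, Some v => v \in [set x; y]
  | None, None => false
  end.

Lemma subdiv_adj_sym : symmetric subdiv_adj.
Proof. by move=> [u|] [v|] //=; rewrite adj_sym setUC. Qed.

Lemma subdiv_adj_irrefl : irreflexive subdiv_adj.
Proof. by move=> [u|] //=; rewrite adj_irrefl. Qed.

(* The subdivision of the edge [xy], meant for adjacent [x] and [y]. *)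
Definition subdivide : sgraph := SGraph subdiv_adj_sym subdiv_adj_irrefl.

End Graph.

Definition iota1_critical (G : sgraph) : Prop :=
  (exists x y : G, adj x y) /\
  forall x y : G, adj x y ->
    isolation_number G < isolation_number (subdivide x y).

(* Main.v *)
(** Suppose a set [S] isolates the subdivision of [xy] with [#|S|] at most the
    isolation number. If [S] avoids the new vertex, it is a minimum isolating
    set of [G], and either an edge from an end of [xy] to the undominated part
    or a half of [xy] is left undominated in the subdivision.
    Otherwise replacing the new vertex by [x] and by [y] yields two critical
    tripartitions, which together force an edge missed by [S]. Conversely, any
    failure of the tripartition axioms for a minimum isolating set [D] gives an
    edge whose subdivision is still isolated by [D], or, when [D] contains a
    leaf, by [D] with the leaf replaced by the new vertex. *)

Require Import Defs.
From mathcomp Require Import all_boot.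
Set Implicit Arguments.
Unset Strict Implicit.
Unset Printing Implicit Defensive.

Lemma set2_eqP (T : finType) (a b c d : T) :
  reflect ((a = c /\ b = d) \/ (a = d /\ b = c)) ([set a; b] == [set c; d]).
Proof.
apply: (iffP eqP) => [E|[[-> ->]|[-> ->]]] //; last by rewrite setUC.
have := set21 a b; have := set22 a b; have := set21 c d; have := set22 c d.
(* Each of the four elements becomes a member of the other pair. *)
rewrite {1 2}E -{1 2}E !inE.
by move=> /orP[]/eqP ? /orP[]/eqP ? /orP[]/eqP ? /orP[]/eqP ?; subst; auto.
Qed.

(** * Domination, isolating sets and packings *)

Section Isolation.
Variable G : sgraph.
Implicit Types (u v x y : G) (D S : {set G}).

Lemma clneighP D v :
  reflect (v \in D \/ exists2 u, u \in D & adj u v) (v \in clneigh D).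
Proof.
rewrite !inE; apply: (iffP orP) => -[vD|]; try by left.
  by case/existsP=> u /andP[uD uv]; right; exists u.
by case=> u uD uv; right; apply/existsP; exists u; rewrite uD.
Qed.

Lemma sub_clneigh D v : v \in D -> v \in clneigh D.
Proof. by move=> vD; apply/clneighP; left. Qed.

Lemma adj_clneigh D u v : u \in D -> adj u v -> v \in clneigh D.
Proof. by move=> uD uv; apply/clneighP; right; exists u. Qed.

Lemma independentP D :
  reflect {in D &, forall u v, ~~ adj u v} (independent D).
Proof.
apply: (iffP forallP) => [H u v uD vD | H u].
  by have /implyP/(_ uD)/forallP/(_ v)/implyP/(_ vD) := H u.
by apply/implyP=> uD; apply/forallP=> v; apply/implyP; apply: H.
Qed.

Lemma isolatingP D :
  reflect (forall u v, adj u v -> u \in clneigh D \/ v \in clneigh D)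
          (isolating D).
Proof.
apply: (iffP (independentP _)) => H u v.
  move=> uv; apply/orP; apply: contraLR uv; rewrite negb_or => /andP[Nu Nv].
  by apply: H; rewrite inE.
rewrite !in_setC => Nu Nv; apply/negP=> /H[]; exact/negP.
Qed.

Lemma isolating_setT : isolating [set: G].
Proof. by apply/isolatingP=> u v _; left; apply: sub_clneigh. Qed.

Lemma isolation_number_le D : isolating D -> isolation_number G <= #|D|.
Proof.
rewrite /isolation_number.
by case: arg_minnP => [|D0 _ minD0]; [apply: isolating_setT | apply: minD0].
Qed.

Lemma min_isolating_exists : exists D : {set G}, min_isolating D.
Proof.
exists [arg min_(D < [set: G] | isolating D) #|D|]; split=> //.
by case: arg_minnP => //; apply: isolating_setT.
Qed.

Lemma min_isolating_le D :
  isolating D -> #|D| <= isolation_number G -> min_isolating D.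
Proof.
by move=> isoD leD; split=> //; apply/eqP; rewrite eqn_leq leD isolation_number_le.
Qed.

Lemma opneighP D v :
  reflect (v \notin D /\ exists2 u, u \in D & adj u v) (v \in opneigh D).
Proof.
rewrite inE; apply: (iffP andP) => [[vD /clneighP[]]|[vD [u uD uv]]] //.
  by rewrite (negPf vD).
by split=> //; apply: adj_clneigh uD uv.
Qed.

(** A distance is the length of some walk, so a lower bound on all walks between distinct members
    suffices. *)
Lemma short_walk_packing (r : nat) S :
  (forall u v p, u \in S -> v \in S -> u != v -> path (@adj G) u p ->
     last u p = v -> r < size p) ->
  packing r S.
Proof.
by move=> H u v uS vS neq k [[p [pth lst <-]] _]; apply: H pth lst.
Qed.

(* A vertex with two neighbours in [S] puts them at distance at most 2. *)
Lemma packing_common_neighbor (r : nat) S u v b : 1 < r -> packing r S ->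
  u \in S -> v \in S -> adj u b -> adj v b -> u = v.
Proof.
move=> r2 pS uS vS ub vb; apply/eqP; apply: contraT => neq.
have bv : adj b v by rewrite adj_sym.
(* [packing] speaks of exact distances: here 1 or 2, according to whether [u] and [v] are
   adjacent. *)
have [uv|nuv] := boolP (adj u v).
  suff /(pS _ _ uS vS neq) : is_dist u v 1 by rewrite ltnNge ltnW.
  split; first by exists [:: v]; rewrite /= uv.
  by case=> [_ /= E|//]; rewrite E eqxx in neq.
suff /(pS _ _ uS vS neq) : is_dist u v 2 by rewrite ltnNge r2.
split; first by exists [:: b; v]; rewrite /= ub bv.
case=> [_ /= E|c [|//]]; first by rewrite E eqxx in neq.
by rewrite /= andbT => uc E; rewrite E (negPf nuv) in uc.
Qed.

End Isolation.

(** * Domination and isolation in the subdivision of [xy] *)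

Section Subdivision.
Variables (G : sgraph) (x y : G).
Implicit Types (u v : G) (D : {set G}) (S : {set subdivide x y}).

Definition old_part S : {set G} := [set v | Some v \in S].

Definition lift D : {set subdivide x y} := [set Some v | v in D].

Lemma mem_lift D v : ((Some v : subdivide x y) \in lift D) = (v \in D).
Proof. by rewrite mem_imset // => a b []. Qed.

Lemma new_notin_lift D : (None : subdivide x y) \notin lift D.
Proof. by apply/imsetP=> -[]. Qed.

Lemma card_lift D : #|lift D| = #|D|.
Proof. by rewrite card_imset // => a b []. Qed.

Lemma lift_old_part S : (None : subdivide x y) \notin S -> S = lift (old_part S).
Proof.
move=> NS; apply/setP=> -[v|]; first by rewrite mem_lift inE.
by rewrite (negPf NS) (negPf (new_notin_lift _)).
Qed.

Lemma card_old_part S : (None : subdivide x y) \in S -> #|S| = #|old_part S|.+1.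
Proof.
move=> NS; rewrite (cardsD1 None) NS add1n -(card_lift (old_part S)).
congr _.+1; apply: eq_card => -[v|]; rewrite !inE ?mem_lift ?inE //.
by rewrite (negPf (new_notin_lift _)).
Qed.

Lemma clneigh_subdivide S v :
  (Some v : subdivide x y) \in clneigh S <->
  [\/ v \in old_part S,
      exists2 u, u \in old_part S & adj u v && ([set u; v] != [set x; y])
    | (None : subdivide x y) \in S /\ v \in [set x; y]].
Proof.
split=> [/clneighP[vS|[[u|] uS uv]]|[vS|[u uS uv]|[NS vxy]]].
- by apply: Or31; rewrite inE.
- by apply: Or32; exists u; rewrite ?inE.
- by apply: Or33.
- by apply/clneighP; left; rewrite inE in vS.
- by apply/clneighP; right; exists (Some u) => //; rewrite inE in uS.
- by apply/clneighP; right; exists None.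
Qed.

Lemma clneigh_subdivide_new S :
  (None : subdivide x y) \in clneigh S <->
  (None : subdivide x y) \in S \/ x \in old_part S \/ y \in old_part S.
Proof.
split=> [/clneighP[NS|[[u|] uS uv]]|[NS|xyS]] //; first by left.
- by right; move: uv; rewrite /= !inE => /orP[]/eqP E; rewrite -E uS; auto.
- by apply/clneighP; left.
by apply/clneighP; right; case: xyS => S_;
  [exists (Some x) | exists (Some y)]; rewrite /= ?inE ?eqxx ?orbT // in S_ *.
Qed.

(** The edges of the subdivision are the old edges other than [xy] and the two halves of [xy]; one
    condition for each kind. *)
Lemma isolating_subdivideP S :
  isolating S <->
  (forall u v, adj u v -> [set u; v] != [set x; y] ->
     (Some u : subdivide x y) \in clneigh S \/
     (Some v : subdivide x y) \in clneigh S) /\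
  (forall u, u \in [set x; y] ->
     (Some u : subdivide x y) \in clneigh S \/
     (None : subdivide x y) \in clneigh S).
Proof.
split=> [/isolatingP iS|[iE iN]].
  split=> [u v uv ne|u uxy]; last exact: (iS (Some u) None).
  by apply: (iS (Some u) (Some v)); rewrite /= uv.
apply/isolatingP=> -[u|] [v|] //=; last by move=> vxy; case: (iN v vxy); auto.
  by case/andP; apply: iE.
exact: iN.
Qed.

Lemma clneigh_lift D v :
  (Some v : subdivide x y) \in clneigh (lift D) <->
  v \in D \/
  (exists2 u, u \in D & adj u v && ([set u; v] != [set x; y])).
Proof.
apply: iff_trans (clneigh_subdivide _ _) _.
have -> : old_part (lift D) = D by apply/setP=> u; rewrite inE mem_lift.
split=> [[]|[]]; auto.
- by rewrite (negPf (new_notin_lift _)) => -[].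
- exact: Or31.
- exact: Or32.
Qed.

Lemma clneigh_old_part S v : (None : subdivide x y) \notin S ->
  (Some v : subdivide x y) \in clneigh S -> v \in clneigh (old_part S).
Proof.
move=> NS /clneigh_subdivide[vS|[u uS /andP[uv _]]|[]].
- exact: sub_clneigh.
- exact: adj_clneigh uS uv.
- by rewrite (negPf NS).
Qed.

(** Only the edge [xy] needs care: an end of one of its halves is dominated, and if that is the new
    vertex, then [x] or [y] lies in [S]. *)
Lemma isolating_old_part S :
  (None : subdivide x y) \notin S -> isolating S -> isolating (old_part S).
Proof.
move=> NS /isolating_subdivideP[iE iN]; apply/isolatingP=> u v uv.
have [/set2_eqP E|ne] := boolP ([set u; v] == [set x; y]); last first.
  by case: (iE u v uv ne) => /(clneigh_old_part NS); auto.
have uxy : u \in [set x; y] by case: E => -[-> _]; rewrite !inE eqxx ?orbT.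
case: (iN u uxy) => [/(clneigh_old_part NS)|/clneigh_subdivide_new]; first by auto.
rewrite (negPf NS) => -[//|]; case: E => -[-> ->] [] /sub_clneigh; auto.
Qed.

(* Either end of the subdivided edge dominates, in [G], the two vertices that
   the new vertex dominates in the subdivision. *)
Lemma isolating_replace_new S z z' :
  [set x; y] = [set z; z'] -> adj z z' ->
  isolating S -> isolating (z |: old_part S).
Proof.
move=> Exy zz' /isolating_subdivideP[iE _]; apply/isolatingP=> u v uv.
have zD : z \in z |: old_part S by rewrite setU11.
have in_xy w : w \in [set x; y] -> w \in clneigh (z |: old_part S).
  rewrite Exy in_set2 => /orP[]/eqP->; first exact: sub_clneigh.
  exact: adj_clneigh zD zz'.
have [/set2_eqP E|ne] := boolP ([set u; v] == [set x; y]).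
  by left; apply: in_xy; case: E => -[-> _]; rewrite !inE eqxx ?orbT.
have dom w : (Some w : subdivide x y) \in clneigh S ->
    w \in clneigh (z |: old_part S).
  case/clneigh_subdivide => [wS|[t tS /andP[tw _]]|[_ /in_xy //]].
    by apply: sub_clneigh; rewrite inE wS orbT.
  by apply: adj_clneigh tw; rewrite inE tS orbT.
by case: (iE u v uv ne) => /dom; auto.
Qed.

End Subdivision.

(** * Critical tripartitions force criticality *)

Section Tripartition.
Variable G : sgraph.
Implicit Types (a b c u v x y z : G) (D : {set G}).

Local Notation tripartition D :=
  (critical_tripartition D (opneigh D) (~: clneigh D)).

Section Edges.
Variable D : {set G}.
Hypothesis triD : tripartition D.

Lemma tripartition_common_neighbor a a' b :
  a \in D -> a' \in D -> adj a b -> adj a' b -> a = a'.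
Proof. exact: packing_common_neighbor (ct_packing triD). Qed.

Lemma tripartition_undominated_neighbor b :
  b \in opneigh D -> exists2 c, c \notin clneigh D & adj b c.
Proof.
have [_ <-] := ct_neigh triD; case/opneighP=> _ [c].
by rewrite in_setC adj_sym => cC bc; exists c.
Qed.

(** Outside [opneigh D] lie only [D] and the undominated vertices, which together form an
    independent set. *)
Lemma tripartition_edge u v : adj u v -> u \notin opneigh D -> v \in opneigh D.
Proof.
have [/independentP iAC _] := ct_indep triD.
have cov w : w \notin opneigh D -> w \in D :|: ~: clneigh D.
  by rewrite /opneigh !inE; case: (w \in D) => //=; case: (existsP _).
by move=> uv /cov uAC; apply: contraLR uv => /cov; apply: iAC.
Qed.

Lemma tripartition_other_neighbor a b :
  a \in D -> adj a b -> exists2 z, adj a z & z != b.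
Proof.
move=> aD ab; have := ct_noleaf triD aD.
rewrite /leaf /degree (cardsD1 b) inE ab add1n eqSS cards_eq0 => /set0Pn[z].
by rewrite !inE => /andP[zb az]; exists z.
Qed.

Lemma tripartition_lift_not_isolating x y :
  adj x y -> ~ isolating (lift x y D).
Proof.
move=> xy /isolating_subdivideP[iE iN].
have [b [z [Exy bz bB zB]]] : exists b z,
    [/\ [set x; y] = [set b; z], adj b z, b \in opneigh D & z \notin opneigh D].
  have [_ /independentP iB] := ct_indep triD.
  have [xB|xB] := boolP (x \in opneigh D).
    exists x, y; split=> //; apply: contraL xy => yB; exact: iB.
  by exists y, x; rewrite setUC adj_sym (tripartition_edge xy).
have [bD [a aD ab]] := opneighP _ _ bB.
(* If [z] is in [D], the packing makes it the only neighbour of [b] in [D]. Subdividing [bz] leaves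
   [b] undominated, and the edge from [b] to an undominated [c] is missed. *)
have [zD|zD] := boolP (z \in D).
  have [c cC bc] := tripartition_undominated_neighbor bB.
  have cz : c != z by apply: contraNneq cC => ->; apply: sub_clneigh.
  have ne : [set b; c] != [set x; y].
    rewrite Exy; apply/set2_eqP=> -[[_ E]|[E _]]; first by rewrite E eqxx in cz.
    by rewrite E adj_irrefl in bz.
  case: (iE b c bc ne) => /clneigh_lift[wD|[t tD /andP[tw]]].
  - by rewrite wD in bD.
  - have -> : t = z by apply: tripartition_common_neighbor tw _; rewrite // adj_sym.
    by rewrite Exy setUC eqxx.
  - by rewrite (sub_clneigh wD) in cC.
  - by rewrite (adj_clneigh tD tw) in cC.
(* Otherwise [z] is undominated, and its half of the edge is missed: neither [b] nor [z] lies in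
   [D], so the new vertex is not dominated. *)
have zC : z \notin clneigh D.
  by apply: contra zB => zcl; rewrite inE zD.
have zxy : z \in [set x; y] by rewrite Exy !inE eqxx orbT.
case: (iN z zxy) => [/clneigh_lift[wD|[t tD /andP[tz _]]]|].
- by rewrite wD in zD.
- by rewrite (adj_clneigh tD tz) in zC.
case/clneighP=> [|[[t|] //]]; first by rewrite (negPf (new_notin_lift _ _ _)).
rewrite mem_lift /= Exy !inE => tD.
by case/orP=> /eqP E; rewrite E ?(negPf bD) ?(negPf zD) in tD.
Qed.

End Edges.

(** As [x] is not a leaf, it has a neighbour [z] other than [y], whose only neighbour in
    [x |: old_part S] is [x]; and [z] has a neighbour [c] undominated by that set. Since [S] lacks
    [x] and the new vertex reaches only [x] and [y], the edge [zc] is missed. *)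
Lemma tripartition_new_not_isolating x y (S : {set subdivide x y}) :
  adj x y -> x \notin old_part S -> y \notin old_part S ->
  tripartition (x |: old_part S) -> tripartition (y |: old_part S) ->
  ~ isolating S.
Proof.
move=> xy xS yS tx ty /isolating_subdivideP[iE _].
have xD : x \in x |: old_part S by rewrite setU11.
have yD : y \in y |: old_part S by rewrite setU11.
have SD w w' : w \in old_part S -> w \in w' |: old_part S.
  by move=> wS; rewrite in_setU1 wS orbT.
have [z xz zy] := tripartition_other_neighbor tx xD xy.
have zx : z != x by apply: contraTneq xz => ->; rewrite adj_irrefl.
have zB : z \in opneigh (x |: old_part S).
  by apply: tripartition_edge xz _; rewrite // inE xD.
have [zD _] := opneighP _ _ zB.
have [c cC zc] := tripartition_undominated_neighbor tx zB.
have Ncl w : w \in old_part S -> ~~ adj w c.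
  by move=> wS; apply: contra cC; apply: adj_clneigh; apply: SD.
have cD : c \notin x |: old_part S by apply: contra cC; apply: sub_clneigh.
have [cx cS] : c != x /\ c \notin old_part S.
  by move: cD; rewrite in_setU1 negb_or => /andP.
have zS : z \notin old_part S by move: zD; rewrite in_setU1 negb_or => /andP[].
have cy : c != y by apply: contraNneq cC => ->; apply: adj_clneigh xD xy.
have ne : [set z; c] != [set x; y].
  by apply/set2_eqP=> -[[E _]|[E _]]; rewrite E eqxx in zx zy.
case: (iE z c zc ne) => /clneigh_subdivide[|[t tS /andP[tw _]]|[_]].
- by rewrite (negPf zS).
- have E : t = x by apply: (tripartition_common_neighbor tx _ _ tw xz) => //; apply: SD.
  by rewrite -E tS in xS.
- by rewrite !inE (negPf zx) (negPf zy).
- by rewrite (negPf cS).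
- by rewrite (negPf (Ncl t tS)) in tw.
- by rewrite !inE (negPf cx) (negPf cy).
Qed.

Lemma tripartition_critical :
  (forall D, min_isolating D -> tripartition D) -> iota1_critical G.
Proof.
move=> tri; split.
  have [D minD] := min_isolating_exists G.
  have [[_ /set0Pn[b /opneighP[_ [a _ ab]]] _] _ _ _ _ _ _] := tri D minD.
  by exists a, b.
move=> x y xy; rewrite ltnNge; apply/negP=> le.
have [S [isoS cardS]] := min_isolating_exists (subdivide x y).
rewrite -cardS in le.
have [NS|NS] := boolP ((None : subdivide x y) \in S); last first.
  have ES := lift_old_part NS.
  have minS : min_isolating (old_part S).
    apply: min_isolating_le; first exact: isolating_old_part.
    by rewrite -(card_lift x y) -ES.
  by apply: (tripartition_lift_not_isolating (tri _ minS) xy); rewrite -ES.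
(* Trading the new vertex for an end keeps the set isolating and no larger, hence minimum. That end
   cannot already be in [S], or the result would be smaller than the isolation number. *)
have rep z z' : [set x; y] = [set z; z'] -> adj z z' ->
    min_isolating (z |: old_part S) /\ z \notin old_part S.
  move=> Exy zz'; have isoz := isolating_replace_new Exy zz' isoS.
  rewrite (card_old_part NS) in le.
  split.
    apply: min_isolating_le => //; apply: leq_trans le.
    by rewrite cardsU1; case: (_ \in _).
  have := leq_trans le (isolation_number_le isoz).
  by rewrite cardsU1; case: (_ \in _); rewrite ?ltnn.
have [/tri tx xS] := rep x y erefl xy.
have [|/tri ty yS] := rep y x (setUC _ _); first by rewrite adj_sym.
exact: tripartition_new_not_isolating tx ty isoS.
Qed.

(** * Criticality forces the tripartition axioms *)

Section Critical.
Hypothesis critG : iota1_critical G.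
Variable D : {set G}.
Hypothesis minD : min_isolating D.

Lemma critical_card x y (S : {set subdivide x y}) :
  adj x y -> isolating S -> #|D| < #|S|.
Proof.
have [_ ->] := minD; move=> xy /isolation_number_le; apply: leq_trans.
by have [_] := critG; apply.
Qed.

Lemma critical_lift_not_isolating x y : adj x y -> ~ isolating (lift x y D).
Proof. by move=> xy /(critical_card xy); rewrite card_lift ltnn. Qed.

(** If [D] dominates as much without [xy], the old edges stay covered, and the dominated ends cover
    both halves, so [D] would isolate the subdivision. *)
Lemma critical_dominated_ends x y : adj x y ->
  (forall v, v \in clneigh D ->
     v \in D \/ exists2 u, u \in D & adj u v && ([set u; v] != [set x; y])) ->
  x \in clneigh D -> y \in clneigh D -> False.
Proof.
move=> xy dom xcl ycl; apply: (critical_lift_not_isolating xy).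
have [/isolatingP isoD _] := minD.
apply/isolating_subdivideP; split=> [u v uv _|u].
  by case: (isoD u v uv) => /dom ?; [left | right]; apply/clneigh_lift.
by rewrite in_set2 => /orP[]/eqP->; left; apply/clneigh_lift; apply: dom.
Qed.

(** An edge inside [D] can be spared, as its ends dominate themselves. *)
Lemma critical_indep_set : independent D.
Proof.
apply/independentP=> x y xD yD; apply/negP=> xy.
apply: (critical_dominated_ends xy); try exact: sub_clneigh.
move=> v /clneighP[|[u uD uv]]; first by left.
have [/set2_eqP E|ne] := boolP ([set u; v] == [set x; y]).
  by left; case: E => -[_ ->].
by right; exists u; rewrite ?uv.
Qed.

(** An edge with no end in [D] carries no domination. *)
Lemma critical_indep_opneigh : independent (opneigh D).
Proof.
apply/independentP=> x y /setDP[xcl xD] /setDP[ycl yD]; apply/negP=> xy.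
apply: (critical_dominated_ends xy) => // v /clneighP[|[u uD uv]]; first by left.
right; exists u; rewrite ?uv //.
by apply/set2_eqP=> -[[E _]|[E _]]; move: uD; rewrite E ?(negPf xD) ?(negPf yD).
Qed.

(** Were they distinct, [ab] could be spared: [a'] still dominates [b]. *)
Lemma critical_common_neighbor a a' b :
  a \in D -> a' \in D -> adj a b -> adj a' b -> a = a'.
Proof.
move=> aD a'D ab a'b; apply/eqP; apply: contraT => neq; exfalso.
apply: (critical_dominated_ends ab) (sub_clneigh aD) (adj_clneigh aD ab).
move=> v /clneighP[|[u uD uv]]; first by left.
have [/set2_eqP [[_ ->]|[_ ->]]|ne] := boolP ([set u; v] == [set a; b]).
- right; exists a' => //; rewrite a'b; apply/set2_eqP=> -[[E _]|[_ E]].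
    by rewrite E eqxx in neq.
  by rewrite E adj_irrefl in ab.
- by left.
by right; exists u; rewrite ?uv.
Qed.

(** Otherwise subdivide [ab] with [a] in [D]. Only [b] can lose its domination, every old edge at
    [b] is covered by its other end, and [a] dominates the new vertex. *)
Lemma critical_undominated_neighbor b :
  b \in opneigh D -> exists2 c, c \notin clneigh D & adj b c.
Proof.
case/opneighP=> bD [a aD ab].
have [/existsP[c /andP[]]|/existsPn noC] :=
  boolP [exists c, (c \notin clneigh D) && adj b c]; first by exists c.
case: (critical_lift_not_isolating ab).
have [/isolatingP isoD _] := minD.
have Nb v : adj b v -> v \in clneigh D.
  by move=> bv; have := noC v; rewrite bv andbT negbK.
have dom v : v \in clneigh D -> v != b ->
    (Some v : subdivide a b) \in clneigh (lift a b D).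
  move=> /clneighP[vD|[u uD uv]] vb; apply/clneigh_lift; first by left.
  have [/set2_eqP E|ne] := boolP ([set u; v] == [set a; b]).
    left; case: E => -[E1 E2]; first by rewrite E2 eqxx in vb.
    by rewrite E2.
  by right; exists u; rewrite ?uv.
apply/isolating_subdivideP; split=> [u v uv _|u _]; last first.
  by right; apply/clneigh_subdivide_new; right; left; rewrite inE mem_lift.
have neq : v != u by apply: contraTneq uv => ->; rewrite adj_irrefl.
have [E|ub] := eqVneq u b.
  by right; rewrite E in uv neq; apply: dom => //; apply: Nb.
have [E|vb] := eqVneq v b.
  by left; apply: dom => //; apply: Nb; rewrite -E adj_sym.
by case: (isoD u v uv) => ?; [left | right]; apply: dom.
Qed.

(** A leaf [a] dominates only itself and its neighbour [b]. In the subdivision of [ab] the new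
    vertex dominates both, so it can replace [a] at equal size. *)
Lemma critical_noleaf a : a \in D -> ~~ leaf a.
Proof.
move=> aD; apply/negP=> /cards1P[b Nab].
have nb v : adj a v = (v == b) by have /setP/(_ v) := Nab; rewrite !inE.
have ab : adj a b by rewrite nb.
pose S : {set subdivide a b} := None |: lift a b (D :\ a).
have NS : None \in S by rewrite !inE eqxx.
have oldS : old_part S = D :\ a.
  by apply/setP=> v; rewrite inE in_setU1 mem_lift.
suff /(critical_card ab) : isolating S.
  by rewrite (card_old_part NS) oldS [X in X < _](cardsD1 a) aD add1n ltnn.
have [/isolatingP isoD _] := minD.
have dom v : v \in clneigh D -> (Some v : subdivide a b) \in clneigh S.
  move=> /clneighP vcl; apply/clneigh_subdivide; rewrite oldS.
  have [vab|vab] := boolP (v \in [set a; b]); first by apply: Or33.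
  move: (vab); rewrite !inE negb_or => /andP[va vb].
  case: vcl => [vD|[u uD uv]]; first by apply: Or31; rewrite va.
  have ua : u != a by apply: contraTneq uv => ->; rewrite nb.
  apply: Or32; exists u; first by rewrite !inE ua.
  rewrite uv; apply: contraNneq vab => <-; exact: set22.
apply/isolating_subdivideP; split=> [u v uv _|u _].
  by case: (isoD u v uv) => /dom; auto.
by right; apply: sub_clneigh.
Qed.

(** A walk of length 1 contradicts independence of [D], one of length 2 gives a common neighbour,
    and one of length 3 has a middle edge inside [opneigh D]. *)
Lemma critical_packing : packing 3 D.
Proof.
have /independentP iD := critical_indep_set.
have /independentP iB := critical_indep_opneigh.
apply: short_walk_packing => u v p uD vD neq.
case: p => [_ /= E|a [|b [|c []]]] //=; first by rewrite E eqxx in neq.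
- by rewrite andbT => ua E; have := iD u v uD vD; rewrite -E ua.
- rewrite andbT => /andP[ua ab] E; rewrite E adj_sym in ab.
  by rewrite (critical_common_neighbor uD vD ua ab) eqxx in neq.
rewrite andbT => /and3P[ua ab bc] E; rewrite E in bc.
have NB w t : w \in D -> adj w t -> t \in opneigh D.
  move=> wD wt; apply/opneighP; split; last by exists w.
  by apply: contraL wt; apply: iD.
rewrite adj_sym in bc.
by have := iB a b (NB _ _ uD ua) (NB _ _ vD bc); rewrite ab.
Qed.

Lemma critical_tripartition_of_min : tripartition D.
Proof.
have [/isolatingP isoD _] := minD.
have /independentP iD := critical_indep_set.
have NC : opneigh (~: clneigh D) = opneigh D.
  apply/setP=> b; apply/opneighP/idP => [[bcl [c]]|bB].
    rewrite in_setC in bcl; rewrite in_setC => cC cb.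
    rewrite inE (negPn bcl) andbT; apply: contra cC => bD.
    by apply: adj_clneigh bD _; rewrite adj_sym.
  have [c cC bc] := critical_undominated_neighbor bB.
  split; first by rewrite in_setC negbK; case/setDP: bB.
  by exists c; rewrite ?in_setC // adj_sym.
(* Any edge has a dominated end; either that end is outside [D], or the other end is, by
   independence. *)
have [b bB] : exists b, b \in opneigh D.
  have [[x [y xy]] _] := critG.
  wlog xcl : x y xy / x \in clneigh D.
    by move=> W; case: (isoD x y xy); [|rewrite adj_sym in xy]; apply: W xy.
  have [xD|xD] := boolP (x \in D); last by exists x; rewrite inE xD.
  exists y; apply/opneighP; split; last by exists x.
  by apply: contraL xy; apply: iD.
have [bD [a aD ab]] := opneighP _ _ bB.
have [c cC bc] := critical_undominated_neighbor bB.
split=> //.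
- by split; apply/set0Pn; [exists a | exists b | exists c; rewrite in_setC].
- split; rewrite -setI_eq0; apply/eqP; apply/setP=> v; rewrite !inE;
    by case: (v \in D) => //=; case: existsP.
- by apply/setP=> v; rewrite !inE; case: (v \in D) => //=; case: existsP.
- split; last exact: critical_indep_opneigh.
  apply/independentP=> u v; rewrite !in_setU !in_setC.
  case/orP=> [uD|uC]; case/orP=> [vD|vC].
  + exact: iD.
  + by apply: contra vC; apply: adj_clneigh.
  + by apply: contra uC; rewrite adj_sym; apply: adj_clneigh.
  + by apply/negP=> /isoD[]; apply/negP.
- exact: critical_packing.
- exact: critical_noleaf.
Qed.

End Critical.

End Tripartition.

Theorem theorem4p5 (G : sgraph) (Gconn : connected G) :
  iota1_critical G <->
  (forall D : {set G}, min_isolating D ->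
     critical_tripartition D (opneigh D) (~: clneigh D)).
Proof.
split; last exact: tripartition_critical.
by move=> critG D; apply: critical_tripartition_of_min.
Qed.
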